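(* For any scalars $C>0$ and $0<\epsilon<1$, any integer $n\geq2$, and any truncated Chebyshev series $f_n$ of degree $n$ with input $x\in[-1,1]$ and real coefficients $c_k$, $0\leq k\leq n$, of the form $$f_n(x)=\sum_{k=0}^n c_kT_k(x),\quad \max_{0\leq k\leq n}|c_k|\leq C,$$ there is a deep ReLU network $\widetilde{f}_n$ with inputs $(x_1,\ldots,x_n)\in[-1,1]^n$ that has depth $$L=\mathcal{O}\left(n\log_2\frac{Cn}{\epsilon}+n^2\right)$$ and size $$W=\mathcal{O}\left(n\log_2\frac{Cn}{\epsilon}+n^2\right),$$ such that $$\left\Vert\widetilde{f}_n(x,\ldots,x)-f_n(x)\right\Vert_{L^\infty([-1,1])}\leq\epsilon.$$
   Context: **Chebyshev polynomials (of the first kind).** $T_0=1$, $T_1(x)=x$ and $T_k(x)=2xT_{k-1}(x)-T_{k-2}(x)$ for $k\geq2$. **Deep ReLU networks.** Let $\sigma(x)=\max(0,x)$. A deep ReLU network has input variables and units arranged in successive hidden layers; each unit computes $\sigma(\boldsymbol{w}\cdot\boldsymbol{z}+\theta)$ with real weights $\boldsymbol{w},\theta$, where $\boldsymbol{z}$ collects network inputs and outputs of units in preceding layers (connections between non-neighboring layers are allowed). The output is an affine combination (real coefficients) of the network inputs and the outputs of the units. The depth $L$ is the number of hidden layers and the size $W$ is the total number of units. The notation $\widetilde{f}_n(x,\ldots,x)$ means that all $n$ inputs are set equal to the same $x$. **$\mathcal{O}$ convention.** Depth or size $\mathcal{O}(X)$ means it is at most $cX$ for an absolute constant $c$ (independent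 of $n$, $C$, $\epsilon$ and the coefficients). Inside $\mathcal{O}(\cdot)$, $\log_2\frac{Cn}{\epsilon}$ is read as $\max\{1,\log_2\frac{Cn}{\epsilon}\}$. *)

(* Defs.v *)
From HB Require Import structures.
From mathcomp Require Import all_boot all_order all_algebra.
From mathcomp Require Import all_classical all_reals all_analysis.

Set Implicit Arguments.
Unset Strict Implicit.
Unset Printing Implicit Defensive.

Import Order.TTheory GRing.Theory Num.Theory.
Import numFieldNormedType.Exports.

Local Open Scope classical_set_scope.
Local Open Scope ring_scope.

Section Chebyshev.
Variable R : realType.

Fixpoint chebyshevT (k : nat) : {poly R} :=
  match k with
  | 0 => 1
  | 1 => 'X
  | (k2.+1 as k1).+1 => 2%:R *: 'X * chebyshevT k1 - chebyshevT k2
  end.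

Definition chebyshev_series (n : nat) (c : 'I_n.+1 -> R) (x : R) : R :=
  \sum_(k < n.+1) c k * (chebyshevT k).[x].

End Chebyshev.

Section ReLU.
Variable R : realType.

Definition relu (x : R) : R := Num.max 0 x.

(* The index m counts the signals available so far: the n network inputs
   followed by the outputs of all units of all layers. As each layer reads all
   of them, connections may skip layers; absent connections have weight 0. *)
Inductive relu_layers (n : nat) : nat -> Type :=
| NoLayer : relu_layers n n
| AddLayer (m w : nat) (prev : relu_layers n m)
    (weights : 'M[R]_(m, w)) (bias : 'rV[R]_w) : relu_layers n (m + w).

Fixpoint layers_depth n m (l : relu_layers n m) : nat :=
  match l with
  | NoLayer => 0
  | AddLayer _ _ l' _ _ => (layers_depth l').+1
  end.

Fixpoint layers_size n m (l : relu_layers n m) : nat :=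
  match l with
  | NoLayer => 0
  | AddLayer _ w l' _ _ => layers_size l' + w
  end.

Fixpoint layers_eval n m (l : relu_layers n m) (x : 'rV[R]_n) : 'rV[R]_m :=
  match l in relu_layers _ m' return 'rV[R]_m' with
  | NoLayer => x
  | AddLayer _ _ l' A b =>
      let z := layers_eval l' x in row_mx z (map_mx relu (z *m A + b))
  end.

Record relu_network (n : nat) := ReluNetwork {
  net_signals : nat;
  net_layers : relu_layers n net_signals;
  out_weights : 'cV[R]_net_signals;
  out_bias : R }.

Definition net_depth n (N : relu_network n) : nat := layers_depth (net_layers N).

Definition net_size n (N : relu_network n) : nat := layers_size (net_layers N).

Definition net_eval n (N : relu_network n) (x : 'rV[R]_n) : R :=
  (layers_eval (net_layers N) x *m out_weights N) 0 0 + out_bias N.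

End ReLU.

Definition log2 (R : realType) (x : R) : R := ln x / ln 2%:R.

Definition Linfty_norm11 (R : realType) (f : R -> R) : \bar R :=
  Lnorm (mrestr (@lebesgue_measure R) (measurable_itv `[(-1 : R), 1])) +oo%E
    (EFin \o f).

(* Main.v *)
Require Import Defs.
From HB Require Import structures.
From mathcomp Require Import all_boot all_order all_algebra.
From mathcomp Require Import all_classical all_reals all_analysis.
From mathcomp Require Import ess_sup_inf ring lra zify.

Import Order.TTheory GRing.Theory Num.Theory.
Import numFieldNormedType.Exports.

Local Open Scope ring_scope.

(** The Chebyshev polynomials are computed one after the other from the
    recurrence [T_(k+2) = 2 x T_(k+1) - T_k], with each product replaced by a
    ReLU approximation; the output layer then forms the combination of the
    [T_k] with coefficients [c k].

    Products reduce by polarization to squares, and squares come from the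
    identity [u ^+ 2 = `|u| - 1/4 + (1 - 2 * `|u|) ^+ 2 / 4]: as
    [1 - 2 * `|u|] stays in [-1, 1] when [u] does, [m] unfoldings leave an error
    of at most [4 ^- m], at the price of [m] absolute values, each of which
    takes one unit ([approx_sqr_error], [extends_approx_sqr]). A product with
    error [8 * 4 ^- m] thus takes [2 * m] units ([approx_mul_error]).

    Since [T_k] is bounded by 1 on [-1, 1], an error on [T_k] grows at most by a
    factor 4 per step of the recurrence ([approx_chebyshevT_error]). Hence
    accuracy [eps] for the series only requires [m] of order
    [n + log2 (C * n / eps)] ([exists_exponent] provides the logarithmic part),
    and the [n] products take [2 * n * m] units, which is the announced bound.
    With one unit per layer, depth and size coincide; this is affordable because
    both are allowed the same order of magnitude. *)

(** * Functions computed by one-unit layers *)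

Section Signals.
Context {R : realType} {n : nat}.
Implicit Types (f g : 'rV[R]_n -> R).

(** [f] is an affine combination of the inputs and of the outputs of all the
    units of [l], that is, exactly what an output layer, or the preactivation
    of a further unit, can compute on top of [l]. *)
Definition affine_signal {m} (l : relu_layers R n m) f :=
  exists (v : 'cV[R]_m) (b : R),
    forall x, f x = (layers_eval l x *m v) 0 0 + b.

Lemma affine_signal_ext {m} {l : relu_layers R n m} {f} g :
  affine_signal l f -> g =1 f -> affine_signal l g.
Proof. by move=> [v [b fE]] gf; exists v, b => x; rewrite gf fE. Qed.

Lemma affine_signal_comb {m} {l : relu_layers R n m} {f g} (a b c : R) :
  affine_signal l f -> affine_signal l g ->
  affine_signal l (fun x => a * f x + b * g x + c).
Proof.
move=> [v [d fE]] [w [e gE]]; exists (a *: v + b *: w), (a * d + b * e + c) => x.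
by rewrite fE gE mulmxDr -!scalemxAr !mxE; ring.
Qed.

Lemma affine_signal_scale {m} {l : relu_layers R n m} {f} (a c : R) :
  affine_signal l f -> affine_signal l (fun x => a * f x + c).
Proof.
move=> fl; apply: (affine_signal_ext _ (affine_signal_comb a 0 c fl fl)) => x.
by rewrite mul0r addr0.
Qed.

Lemma affine_signal_input {m} (l : relu_layers R n m) (i : 'I_n) :
  affine_signal l (fun x => x 0 i).
Proof.
elim: l => [|{}m w l [v [b lE]] A c].
  exists (delta_mx i 0), 0 => x; rewrite addr0 mxE (bigD1 i) //= !mxE !eqxx mulr1.
  by rewrite big1 ?addr0 // => j /negbTE ji; rewrite mxE ji mulr0.
by exists (col_mx v 0), b => x; rewrite lE /= mul_row_col mulmx0 addr0.
Qed.

Lemma affine_signal_cst {m} (l : relu_layers R n m) (c : R) :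
  affine_signal l (fun=> c).
Proof. by exists 0, c => x; rewrite mulmx0 mxE add0r. Qed.

Lemma affine_signal_sum {m} (l : relu_layers R n m) k (c : 'I_k -> R)
    (F : 'I_k -> 'rV[R]_n -> R) :
  (forall i, affine_signal l (F i)) ->
  affine_signal l (fun x => \sum_(i < k) c i * F i x).
Proof.
elim: k c F => [|k IHk] c F Fl.
  by apply: (affine_signal_ext _ (affine_signal_cst l 0)) => x; rewrite big_ord0.
have IH := IHk (fun i => c (widen_ord (leqnSn k) i)) _
  (fun i => Fl (widen_ord (leqnSn k) i)).
apply: (affine_signal_ext _
  (affine_signal_comb 1 (c ord_max) 0 IH (Fl ord_max))) => x.
by rewrite big_ord_recr /= mul1r addr0.
Qed.

(** [l'] costs [k] more layers and [k] more units than [l], and loses none of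
    its signals. Depth and size grow together because all constructions below
    put a single unit in each layer. *)
Definition extends (k : nat) {m m'} (l : relu_layers R n m)
    (l' : relu_layers R n m') :=
  [/\ layers_depth l' = (layers_depth l + k)%N,
      layers_size l' = (layers_size l + k)%N
    & forall f, affine_signal l f -> affine_signal l' f].

Lemma extends_refl {m} (l : relu_layers R n m) : extends 0 l l.
Proof. by split; rewrite ?addn0. Qed.

Lemma extends_trans {j k m1 m2 m3} {l1 : relu_layers R n m1}
    {l2 : relu_layers R n m2} {l3 : relu_layers R n m3} :
  extends j l1 l2 -> extends k l2 l3 -> extends (j + k) l1 l3.
Proof.
move=> [d12 s12 f12] [d23 s23 f23]; split; first by rewrite d23 d12 addnA.
  by rewrite s23 s12 addnA.
by move=> f /f12/f23.
Qed.

Lemma extends_relu {m} {l : relu_layers R n m} {f} : affine_signal l f ->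
  exists m' (l' : relu_layers R n m'),
    extends 1 l l' /\ affine_signal l' (fun x => relu (f x)).
Proof.
move=> [v [b fE]]; exists (m + 1)%N, (AddLayer l v (const_mx b)); split.
  split => [|//|g [w [c gE]]]; first by rewrite /= addn1.
  by exists (col_mx w 0), c => x; rewrite gE /= mul_row_col mulmx0 addr0.
exists (col_mx 0 1%:M), 0 => x.
by rewrite /= mul_row_col mulmx0 add0r mulmx1 addr0 !mxE fE mxE.
Qed.

Lemma extends_norm {m} {l : relu_layers R n m} {f} : affine_signal l f ->
  exists m' (l' : relu_layers R n m'),
    extends 1 l l' /\ affine_signal l' (fun x => `|f x|).
Proof.
move=> fl; have [m' [l' [ll' rl']]] := extends_relu fl; exists m', l'.
split=> //; have [_ _ sub] := ll'.
(* |u| = 2 relu u - u *)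
apply: (affine_signal_ext _ (affine_signal_comb 2 (-1) 0 rl' (sub _ fl))) => x.
by rewrite /relu; case: (ger0P (f x)) => _; lra.
Qed.

End Signals.

(** * Approximate squaring and multiplication *)

Section Arithmetic.
Context {R : realType}.
Implicit Type u : R.

(** The approximation of [u ^+ 2] obtained by unfolding [m] times the identity
    [u ^+ 2 = `|u| - 1/4 + (1 - 2 * `|u|) ^+ 2 / 4], whose right-hand side
    squares a number that is again in [-1, 1]. *)
Fixpoint approx_sqr (m : nat) (u : R) : R :=
  if m is m'.+1 then `|u| - 1 / 4 + approx_sqr m' (1 - 2 * `|u|) / 4 else 0.

Lemma approx_sqr_error m u : `|u| <= 1 -> `|approx_sqr m u - u ^+ 2| <= 4^-1 ^+ m.
Proof.
elim: m u => [|m IHm] u u1 /=.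
  by rewrite sub0r normrN normrX expr0 exprn_ile1.
have -> : `|u| - 1 / 4 + approx_sqr m (1 - 2 * `|u|) / 4 - u ^+ 2
    = 4^-1 * (approx_sqr m (1 - 2 * `|u|) - (1 - 2 * `|u|) ^+ 2).
  by rewrite -(real_normK (num_real u)); field.
have i4 : 0 < 4^-1 :> R by rewrite invr_gt0.
rewrite normrM [leRHS]exprS (gtr0_norm i4) ler_pM2l //.
by apply: IHm; rewrite ler_norml; have := normr_ge0 u; lra.
Qed.

(** By polarization, [x * y = 4 * (((x + y) / 4) ^+ 2 - ((x - y) / 4) ^+ 2)]; the
    scaling by 4 keeps the squared numbers in [-1, 1] when [`|x| <= 1] and
    [`|y| <= 2]. *)
Definition approx_mul (m : nat) (x y : R) : R :=
  4 * (approx_sqr m ((x + y) / 4) - approx_sqr m ((x - y) / 4)).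

Lemma approx_mul_error m (x y : R) : `|x| <= 1 -> `|y| <= 2 ->
  `|approx_mul m x y - x * y| <= 8 * 4^-1 ^+ m.
Proof.
rewrite !ler_norml => /andP[x0 x1] /andP[y0 y1].
have D1 : `|(x + y) / 4| <= 1 by rewrite ler_norml; lra.
have D2 : `|(x - y) / 4| <= 1 by rewrite ler_norml; lra.
have := approx_sqr_error m _ D1; have := approx_sqr_error m _ D2.
rewrite !ler_norml /approx_mul.
have -> : x * y = 4 * (((x + y) / 4) ^+ 2 - ((x - y) / 4) ^+ 2) by field.
by lra.
Qed.

Context {n : nat}.
Implicit Types (f g : 'rV[R]_n -> R).

Lemma extends_approx_sqr s {m} {l : relu_layers R n m} {f} : affine_signal l f ->
  exists m' (l' : relu_layers R n m'),
    extends s l l' /\ affine_signal l' (fun x => approx_sqr s (f x)).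
Proof.
elim: s m l f => [|s IHs] m l f fl.
  by exists m, l; split; [exact: extends_refl|exact: affine_signal_cst].
have [m1 [l1 [ll1 al1]]] := extends_norm fl.
have [m2 [l2 [ll2 sl2]]] := IHs _ _ _ (affine_signal_scale (-2) 1 al1).
exists m2, l2; split; first by rewrite -add1n; exact: extends_trans ll1 ll2.
have [_ _ sub] := ll2.
apply: (affine_signal_ext _
  (affine_signal_comb 1 4^-1 (- (1 / 4)) (sub _ al1) sl2)) => x /=.
by rewrite mulNr (addrC (- _)); ring.
Qed.

Lemma extends_approx_mul s {m} {l : relu_layers R n m} {f g} :
  affine_signal l f -> affine_signal l g ->
  exists m' (l' : relu_layers R n m'),
    extends (s + s) l l' /\ affine_signal l' (fun x => approx_mul s (f x) (g x)).
Proof.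
move=> fl gl.
have [m1 [l1 [ll1 pl1]]] :=
  extends_approx_sqr s (affine_signal_comb 4^-1 4^-1 0 fl gl).
have [_ _ sub1] := ll1.
have [m2 [l2 [ll2 ql2]]] := extends_approx_sqr s
  (affine_signal_comb 4^-1 (- 4^-1) 0 (sub1 _ fl) (sub1 _ gl)).
have [_ _ sub2] := ll2.
exists m2, l2; split; first exact: extends_trans ll1 ll2.
apply: (affine_signal_ext _ (affine_signal_comb 4 (-4) 0 (sub2 _ pl1) ql2)) => x.
rewrite /approx_mul; have -> : (f x + g x) / 4 = 4^-1 * f x + 4^-1 * g x + 0.
  by field.
have -> : (f x - g x) / 4 = 4^-1 * f x + - 4^-1 * g x + 0 by field.
by ring.
Qed.

End Arithmetic.

(** * Approximate Chebyshev polynomials *)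

Section Chebyshev.
Context {R : realType}.

Lemma horner_chebyshevTSS k (x : R) :
  (chebyshevT R k.+2).[x] = 2 * (x * (chebyshevT R k.+1).[x])
                            - (chebyshevT R k).[x].
Proof.
by rewrite [chebyshevT _ k.+2]/= hornerD hornerN hornerM hornerZ hornerX mulrA.
Qed.

Lemma chebyshevT_cos k (t : R) : (chebyshevT R k).[cos t] = cos (k%:R * t).
Proof.
suff: (chebyshevT R k).[cos t] = cos (k%:R * t) /\
      (chebyshevT R k.+1).[cos t] = cos (k.+1%:R * t) by case.
elim: k => [|k [IHk IHk1]]; first by rewrite /= !hornerE cos0.
split=> //; rewrite horner_chebyshevTSS IHk IHk1.
have -> : k.+2%:R * t = k.+1%:R * t + t by rewrite -(natr1 k.+1); ring.
have -> : k%:R * t = k.+1%:R * t - t by rewrite -(natr1 k); ring.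
by rewrite cosB cosD; ring.
Qed.

Lemma chebyshevT_norm_le1 k (x : R) : `|x| <= 1 -> `|(chebyshevT R k).[x]| <= 1.
Proof.
rewrite ler_norml => x1; rewrite -(acosK x1) chebyshevT_cos ler_norml.
by rewrite cos_geN1 cos_le1.
Qed.

(** The three-term recurrence with the product replaced by [approx_mul m]. *)
Fixpoint approx_chebyshevT (m k : nat) (x : R) : R :=
  match k with
  | 0 => 1
  | 1 => x
  | (k2.+1 as k1).+1 =>
      2 * approx_mul m x (approx_chebyshevT m k1 x) - approx_chebyshevT m k2 x
  end.

(** As [T_(k+1)] and [x] are bounded by 1, one step of the recurrence turns errors [e1], [e2] into at most
    [2 * e1 + e2 + 16 * 4^-1 ^+ m], so that a factor 4 per degree absorbs
    everything; the bound on [m] keeps the approximants in the range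
    [-2, 2] where [approx_mul] is accurate. *)
Lemma approx_chebyshevT_error m n k (x : R) :
  (n.+2 <= m)%N -> (k <= n)%N -> `|x| <= 1 ->
  `|approx_chebyshevT m k x - (chebyshevT R k).[x]| <= 4 ^+ k * (16 * 4^-1 ^+ m).
Proof.
move=> nm kn x1; move dE : (16 * 4^-1 ^+ m) => d.
have d0 : 0 <= d by rewrite -dE mulr_ge0 // exprn_ge0 // invr_ge0.
have d_le1 j : (j <= n)%N -> 4 ^+ j * d <= 1.
  move=> jn; have -> : d = 4^-1 ^+ (m - 2).
    by rewrite -dE -[in LHS](subnK (leq_trans _ nm : (2 <= m)%N)) // exprD; field.
  rewrite exprVn ler_pdivrMr ?exprn_gt0 // mul1r ler_eXn2l ?ltr1n //.
  by lia.
suff: (k <= n)%N ->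
    `|approx_chebyshevT m k x - (chebyshevT R k).[x]| <= 4 ^+ k * d /\
    ((k < n)%N ->
    `|approx_chebyshevT m k.+1 x - (chebyshevT R k.+1).[x]| <= 4 ^+ k.+1 * d).
  by case.
elim: k {kn} => [|k IHk] kn.
  by split=> [|_]; rewrite /= !hornerE subrr normr0 ?mulr_ge0 ?exprn_ge0.
have [/(_ kn) ek1 ek] : ((k < n)%N ->
    `|approx_chebyshevT m k.+1 x - (chebyshevT R k.+1).[x]| <= 4 ^+ k.+1 * d) /\
    `|approx_chebyshevT m k x - (chebyshevT R k).[x]| <= 4 ^+ k * d.
  by case: (IHk (ltnW kn)).
split=> // k2n; rewrite horner_chebyshevTSS.
have T1 := chebyshevT_norm_le1 k.+1 x x1; have d1 := d_le1 _ kn.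
have A2 : `|approx_chebyshevT m k.+1 x| <= 2.
  by move: T1 ek1 d1; rewrite !ler_norml; lra.
have M := approx_mul_error m _ _ x1 A2.
have X : `|x * approx_chebyshevT m k.+1 x - x * (chebyshevT R k.+1).[x]|
    <= 4 ^+ k.+1 * d.
  rewrite -mulrBr normrM; apply: le_trans ek1; exact: ler_piMl.
have d4 : d <= 4 ^+ k * d.
  by rewrite ler_peMl // exprn_ege1 // ler1n.
have {}M : `|approx_mul m x (approx_chebyshevT m k.+1 x)
             - x * approx_chebyshevT m k.+1 x| <= d / 2.
  by apply: le_trans M _; rewrite -dE; lra.
move: M X ek; rewrite !exprS -!mulrA; set e := 4 ^+ k * d in d4 *.
rewrite [approx_chebyshevT _ k.+2 _]/=.
by rewrite !ler_norml; lra.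
Qed.

Lemma extends_approx_chebyshevT {n} (i : 'I_n) m k :
  exists q (l : relu_layers R n q),
    extends (k * (m + m)) (NoLayer R n) l /\
    forall j, (j <= k.+1)%N ->
      affine_signal l (fun x => approx_chebyshevT m j (x 0 i)).
Proof.
elim: k => [|k [q [l [ll lT]]]].
  exists n, (NoLayer R n); split; first exact: extends_refl.
  case=> [|[|//]] _; first exact: affine_signal_cst.
  exact: affine_signal_input.
have [q' [l' [ll' l'M]]] :=
  extends_approx_mul m (affine_signal_input l i) (lT _ (leqnn _)).
exists q', l'; split; first by rewrite mulSn addnC; exact: extends_trans ll ll'.
have [_ _ sub] := ll'.
move=> j; rewrite leq_eqVlt ltnS => /orP[/eqP->|jk]; last exact/sub/lT.
apply: (affine_signal_ext _
  (affine_signal_comb 2 (-1) 0 l'M (sub _ (lT k (leqnSn k))))) => x.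
by rewrite /=; ring.
Qed.

End Chebyshev.

(** * Uniform norm and choice of the accuracy *)

(** The complement of [-1, 1] is null for the restricted measure, so that no
    measurability of [f] is needed. *)
Lemma Linfty_norm11_le {R : realType} (f : R -> R) (e : R) : 0 <= e ->
  (forall x, `|x| <= 1 -> `|f x| <= e) -> (Linfty_norm11 f <= e%:E)%E.
Proof.
move=> e0 fe; rewrite /Linfty_norm11 unlock /=; case: ifPn => // _.
apply/ess_supP; exists (~` `[(-1 : R), 1])%classic; split.
- exact: measurableC.
- by rewrite /= /mrestr setICl measure0.
- move=> x /= nfx; rewrite in_itv /= -ler_norml => x1; apply: nfx.
  by rewrite lee_fin fe.
Qed.

(** The maximum with 1 also covers small [y], where the logarithm is
    negative, and leaves room for rounding up. *)
Lemma exists_exponent {R : realType} (y : R) : 0 < y ->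
  exists2 p : nat, 2 * y <= 4 ^+ p & p%:R <= 2 * Num.max 1 (log2 y).
Proof.
move=> y0; set M := Num.max 1 (log2 y); have M1 : 1 <= M by rewrite le_max lexx.
have M0 : 0 <= M by lra.
exists (Num.truncn M).+1; last first.
  have := truncn_le M; rewrite M0 -natr1; lra.
have := truncnS_gt M; move: (Num.truncn M) => p Mp.
have yp : y <= 2 ^+ p.+1.
  have ln2 : 0 < ln 2 :> R by rewrite ln_gt0 // ltr1n.
  rewrite -ler_ln ?posrE ?exprn_gt0 // lnXn // -[leRHS]mulr_natl -ler_pdivrMr //.
  by apply: le_trans (ltW Mp); rewrite /M le_max lexx orbT.
have -> : 4 = 2 * 2 :> R by rewrite -natrM.
rewrite exprMn; apply: ler_pM => //; first exact: ltW.
by rewrite exprS ler_peMr // exprn_ege1 // ler1n.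
Qed.

Theorem proposition2p5 (R : realType) :
  exists K : R,
    forall (C eps : R) (n : nat) (c : 'I_n.+1 -> R),
      0 < C -> 0 < eps -> eps < 1 -> (2 <= n)%N ->
      \big[Num.max/0]_(k < n.+1) `|c k| <= C ->
      exists N : relu_network R n,
        [/\ (net_depth N)%:R <=
              K * (n%:R * Num.max 1 (log2 (C * n%:R / eps)) + n%:R ^+ 2),
            (net_size N)%:R <=
              K * (n%:R * Num.max 1 (log2 (C * n%:R / eps)) + n%:R ^+ 2)
          & (Linfty_norm11
               (fun x : R => net_eval N (const_mx x) - chebyshev_series c x)%R
             <= eps%:E)%E].
Proof.
exists 4 => C eps n c C0 eps0 eps1 n2 cC.
have n2R : 2 <= n%:R :> R by rewrite ler_nat.
have y0 : 0 < C * n%:R / eps by rewrite divr_gt0 // mulr_gt0 //; lra.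
have [p py pM] := exists_exponent _ y0.
set M := Num.max 1 _ in pM *.
(* 4 ^- (n + 2) absorbs the growth 16 * 4 ^ n of the error, 4 ^- p the factor
   C * (n + 1) / eps due to the summation. *)
pose m := (n.+2 + p)%N.
(* As all the inputs are equal, the network may read the first one only. *)
pose i0 := Ordinal (ltnW n2).
have [q [l [[ld ls _] lT]]] := extends_approx_chebyshevT (R := R) i0 m n.
have lT' (k : 'I_n.+1) :
    affine_signal l (fun x => approx_chebyshevT m k (x 0 i0)).
  by apply: lT; exact: ltnW.
have [v [b vE]] := affine_signal_sum l n.+1 c _ lT'.
have size_bound : (n * (m + m))%:R <= 4 * (n%:R * M + n%:R ^+ 2).
  have -> : 4 * (n%:R * M + n%:R ^+ 2) = n%:R * (4 * (M + n%:R)) by ring.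
  rewrite natrM ler_wpM2l // natrD /m natrD -addn2 natrD; lra.
exists (ReluNetwork l v b); split.
- by rewrite /net_depth ld.
- by rewrite /net_size ls.
apply: Linfty_norm11_le => [|x x1]; first exact: ltW.
rewrite /net_eval /= -vE /chebyshev_series -sumrB.
have err (k : 'I_n.+1) : `|c k * approx_chebyshevT m k (const_mx x 0 i0)
    - c k * (chebyshevT R k).[x]| <= C * 4^-1 ^+ p.
  rewrite mxE -mulrBr normrM; apply: ler_pM => //.
    by apply: le_trans cC; exact: (le_bigmax _ (fun k => `|c k|)).
  have kn : (k <= n)%N by rewrite -ltnS.
  apply: le_trans (approx_chebyshevT_error m n k x (leq_addr _ _) kn x1) _.
  have -> : 16 * 4^-1 ^+ m = 4^-1 ^+ n * 4^-1 ^+ p :> R.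
    by rewrite /m -(addn2 n) !exprD; field.
  rewrite mulrA ler_piMl ?exprn_ge0 ?invr_ge0 // exprVn.
  by rewrite ler_pdivrMr ?exprn_gt0 // mul1r ler_eXn2l ?ltr1n.
apply: le_trans (ler_norm_sum _ _ _) _.
apply: (@le_trans _ _ (\sum_(k < n.+1) C * 4^-1 ^+ p)).
  by apply: ler_sum => k _; exact: err.
rewrite sumr_const card_ord -[leLHS]mulr_natl exprVn mulrA.
rewrite ler_pdivrMr ?exprn_gt0 //.
move: py; rewrite mulrA ler_pdivrMr // => py.
rewrite mulrC (mulrC eps); apply: le_trans py.
by rewrite mulrCA ler_pM2l // -natr1; lra.
Qed.
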